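(* Let $\mathcal{P}$ be a simple type system on $\Omega$ that is either multinuclear or atomic branching quasinuclear. Then $\operatorname{Stab}_V(\mathcal{P})$ is a maximal subgroup of Thompson's group $V$.
   Context: $\mathfrak{C}$ is the Cantor space of infinite words over $\{0,1\}$ and $\Omega$ is the set of all finite words over $\{0,1\}$ (including the empty word), called addresses; $|\alpha|$ is the length of $\alpha$. For $\alpha\in\Omega$ the cone is $\alpha\mathfrak{C}=\{\alpha w\mid w\in\mathfrak{C}\}$. Thompson's group $V$ is the group (under composition) of all maps $\mathfrak{C}\to\mathfrak{C}$ for which there are two partitions $\alpha_1\mathfrak{C},\dots,\alpha_n\mathfrak{C}$ and $\beta_1\mathfrak{C},\dots,\beta_n\mathfrak{C}$ of $\mathfrak{C}$ into disjoint cones such that $\alpha_iw\mapsto\beta_iw$ for all $i$ and all $w\in\mathfrak{C}$. $V$ acts partially on $\Omega$ on the right: $\alpha^g=\beta$ if $g$ maps $\alpha w\mapsto\beta w$ for all $w\in\mathfrak{C}$; if there is no such $\beta$, then $\alpha^g$ is undefined. A type system on $\Omega$ is the partition $\mathcal{P}$ of $\Omega$ into the classes (called types) of an equivalence relation $\sim$ such that for all $\alpha,\beta\in\Omega$: $\alpha\sim\beta$ if and only if both $\alpha0\sim\beta0$ and $\alpha1\sim\beta1$. (Type systems need not be finite.) A type system $\mathcal{Q}$ (relation $\approx$) is a quotient of $\mathcal{P}$ if $\alpha\sim\beta$ implies $\alpha\approx\beta$; it is proper if $\mathcal{Q}\ne\mathcal{P}$. The universal relation is the one in which all addresses are related. $\mathcal{P}$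 is simple if its only proper quotient is the type system of the universal relation (in particular the universal type system itself is not simple). $\operatorname{Stab}_V(\mathcal{P})$ is the subgroup of all $g\in V$ for which there is a cofinite $\Omega_0\subseteq\Omega$ such that $\alpha^g$ is defined for all $\alpha\in\Omega_0$ and, for all $\alpha,\beta\in\Omega_0$, $\alpha\sim\beta$ if and only if $\alpha^g\sim\beta^g$. For $P\in\mathcal{P}$ and $\gamma\in\Omega$, $P_\gamma$ denotes the type of $\alpha\gamma$ for any $\alpha\in P$. A non-empty $\mathcal{S}\subseteq\mathcal{P}$ is child-closed if $P\in\mathcal{S}$ implies $P_0,P_1\in\mathcal{S}$; strongly connected if for all $P,Q\in\mathcal{S}$ there is a non-empty word $\gamma$ with $P_\gamma=Q$ and $P_\zeta\in\mathcal{S}$ for every prefix $\zeta$ of $\gamma$; and a nucleus if it is child-closed and strongly connected. $\mathcal{P}$ is multinuclear if there are a positive integer $t$ and finitely many (at least one) disjoint nuclei $\mathcal{Q}^{(1)},\dots,\mathcal{Q}^{(k)}\subseteq\mathcal{P}$ such that every address $\alpha$ with $|\alpha|\ge t$ has type in one of the $\mathcal{Q}^{(i)}$. $\mathcal{P}$ is quasinuclear if there are a positive integer $t$ and non-empty disjoint subsets $\mathcal{Q},\mathcal{R}\subseteq\mathcal{P}$ such that: (a) every address $\alpha$ with $|\alpha|\geq t$ has type in $\mathcal{Q}\cup\mathcal{R}$; (b) $\mathcal{R}$ is a nucleus; (c) $\mathcal{Q}$ is strongly connected; (d) $\mathcal{Q}\cup\mathcal{R}$ is child-closed; (e) for all $Q\in\mathcal{Q}$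 and $R\in\mathcal{R}$ there is a word $\gamma$ with $Q_\gamma=R$. It is atomic if $\mathcal{R}$ consists of a single type, and branching if there is some $Q\in\mathcal{Q}$ with both $Q_0,Q_1\in\mathcal{Q}$. *)

(* Defs.v *)
From mathcomp Require Import all_boot.
From mathcomp Require Import boolp classical_sets cardinality.

Set Implicit Arguments.
Unset Strict Implicit.
Unset Printing Implicit Defensive.

Local Open Scope classical_set_scope.

Definition cantor := nat -> bool.
Definition address := seq bool.

Definition prepend (a : address) (w : cantor) : cantor :=
  fun n => if (n < size a)%N then nth false a n else w (n - size a)%N.

Definition cone (a : address) : set cantor := range (prepend a).

Definition cone_partition n (a : 'I_n -> address) : Prop :=
  classical_sets.partition setT (fun i => cone (a i)) setT.

(* Maps are compared by Leibniz equality, which is extensional equality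
   thanks to functional extensionality. *)
Definition thompsonV : set (cantor -> cantor) :=
  [set g | exists n (a b : 'I_n -> address),
     [/\ cone_partition a, cone_partition b &
         forall i w, g (prepend (a i) w) = prepend (b i) w]].

(* Subgroups of a group [G] of bijections of [T] under composition; the last
   clause says that [H] contains the inverse of each of its elements. *)
Definition is_subgroup T (G H : set (T -> T)) : Prop :=
  [/\ H `<=` G,
      H id,
      forall f g, H f -> H g -> H (g \o f) &
      forall f g, H f -> cancel f g -> cancel g f -> H g].

Definition maximal_subgroup T (G M : set (T -> T)) : Prop :=
  [/\ is_subgroup G M,
      M <> G &
      forall H, is_subgroup G H -> M `<=` H -> H = M \/ H = G].

(* [address_image g a b] is the graph of the partial action: a^g is defined
   and equal to b. *)
Definition address_image (g : cantor -> cantor) (a b : address) : Prop :=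
  forall w, g (prepend a w) = prepend b w.

Record type_system := TypeSystem {
  same_type :> address -> address -> Prop;
  same_type_refl : forall a, same_type a a;
  same_type_sym : forall a b, same_type a b -> same_type b a;
  same_type_trans :
    forall a b c, same_type a b -> same_type b c -> same_type a c;
  same_type_children : forall a b,
    same_type a b <->
    same_type (rcons a false) (rcons b false) /\
    same_type (rcons a true) (rcons b true)
}.

Definition type_of (P : type_system) (a : address) : set address :=
  [set b | P a b].

Definition types (P : type_system) : set (set address) := range (type_of P).

Definition universal_type_system : type_system :=
  @TypeSystem (fun _ _ => True) (fun _ => I) (fun _ _ _ => I)
    (fun _ _ _ _ _ => I)
    (fun _ _ => conj (fun _ => conj I I) (fun _ => I)).

Definition quotient (P Q : type_system) : Prop :=
  forall a b, P a b -> Q a b.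

Definition proper_quotient (P Q : type_system) : Prop :=
  quotient P Q /\ types Q <> types P.

(* The partition into types, not the record, is what identifies a type system,
   so equality of type systems is equality of their sets of types. *)
Definition simple (P : type_system) : Prop :=
  forall Q, proper_quotient P Q <-> types Q = types universal_type_system.

Definition stabV (P : type_system) : set (cantor -> cantor) :=
  [set g | thompsonV g /\
     exists A : set address,
       [/\ finite_set (~` A),
           forall a, A a -> exists b, address_image g a b &
           forall a b a' b', A a -> A b ->
             address_image g a a' -> address_image g b b' ->
             (P a b <-> P a' b')]].

(* P_gamma, for a type [X] of [P] *)
Definition descendant (P : type_system) (X : set address) (c : address) :
    set address :=
  [set b | exists2 a, X a & P (a ++ c) b].

Lemma descendant_type_of (P : type_system) (a c : address) :
  descendant P (type_of P a) c = type_of P (a ++ c).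
Proof.
have catP x y : P x y -> P (x ++ c) (y ++ c).
  elim: c x y => [|i c IH] x y xy; first by rewrite !cats0.
  rewrite -!cat_rcons; apply: IH.
  by case: i; case/same_type_children: xy.
apply/seteqP; split=> [b [x ax xb]|b ab].
  exact: same_type_trans (catP _ _ ax) xb.
by exists a => //; exact: same_type_refl.
Qed.

Section Families.
Variable P : type_system.
Implicit Types S Q R : set (set address).

Definition child_closed S : Prop :=
  forall X, S X -> forall i : bool, S (descendant P X [:: i]).

Definition strongly_connected S : Prop :=
  forall X Y, S X -> S Y -> exists c : address,
    [/\ c <> [::], descendant P X c = Y &
        forall z : address, prefix z c -> S (descendant P X z)].

Definition nucleus S : Prop :=
  [/\ S `<=` types P, S !=set0, child_closed S & strongly_connected S].

Definition multinuclear : Prop :=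
  exists (t k : nat) (Q : 'I_k -> set (set address)),
    [/\ (0 < t)%N, (0 < k)%N, forall i, nucleus (Q i), trivIset setT Q &
        forall a : address, (t <= size a)%N -> exists i, Q i (type_of P a)].

Definition quasinuclear_with (t : nat) Q R : Prop :=
  [/\ (0 < t)%N,
      [/\ Q `<=` types P, R `<=` types P, Q !=set0, R !=set0 &
          Q `&` R = set0] &
      [/\ forall a : address, (t <= size a)%N -> (Q `|` R) (type_of P a),
          nucleus R,
          strongly_connected Q,
          child_closed (Q `|` R) &
          forall X Y, Q X -> R Y -> exists c, descendant P X c = Y]].

Definition atomic R : Prop := exists X, R = [set X].

Definition branching Q : Prop :=
  exists X, [/\ Q X, Q (descendant P X [:: false]) &
                Q (descendant P X [:: true])].

Definition atomic_branching_quasinuclear : Prop :=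
  exists t Q R, [/\ quasinuclear_with t Q R, atomic R & branching Q].

End Families.

(* Main.v *)
(* Let H be an overgroup of Stab_V(P).  Call incomparable addresses a, b
   swappable when H contains the swaps of the cones of ac and bc for all c, and
   linked when, for some n, ac and bc are joined by a chain of two swappable
   pairs for all |c| = n.  Both hypotheses on P make each deep address a have two
   incomparable descendants of its own type; hence, finitely many small cones
   being given, the type of a recurs below a outside all of them.  This free
   room shortens longer chains of swappable pairs to length two, so that
   linkedness is a type system, and a quotient of P.  Since P is simple, there
   are two cases.  If linkedness is P, then H, which preserves linkedness, is
   contained in Stab_V(P).  If linkedness is universal, then H contains every
   swap, and swaps generate V. *)
From mathcomp Require Import all_boot.
From mathcomp Require Import boolp classical_sets cardinality.
Require Import Defs.

Set Implicit Arguments.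
Unset Strict Implicit.
Unset Printing Implicit Defensive.

Local Open Scope classical_set_scope.

(** * Addresses and cones *)

Definition shift (k : nat) (w : cantor) : cantor := fun n => w (k + n).

Definition starts (a : address) (w : cantor) : bool := mkseq w (size a) == a.

Definition incomp (a b : address) : bool := ~~ (prefix a b || prefix b a).

Lemma prepend_cat a b w : prepend (a ++ b) w = prepend a (prepend b w).
Proof.
apply: funext => n; rewrite /prepend size_cat nth_cat.
case: (ltnP n (size a)) => an; first by rewrite ltn_addr.
by rewrite ltn_subLR // subnDA.
Qed.

Lemma prepend_nil w : prepend [::] w = w.
Proof. by apply: funext => n; rewrite /prepend /= subn0. Qed.

Lemma prepend_shift a w : starts a w -> prepend a (shift (size a) w) = w.
Proof.
move/eqP=> aw; apply: funext => n; rewrite /prepend /shift.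
case: (ltnP n (size a)) => an; last by rewrite subnKC.
by rewrite -aw nth_mkseq // size_mkseq.
Qed.

Lemma shift_prepend a w : shift (size a) (prepend a w) = w.
Proof.
apply: funext => n; rewrite /prepend /shift ltnNge leq_addr /=.
by rewrite addKn.
Qed.

Lemma mkseq_prepend b w k : k <= size b -> mkseq (prepend b w) k = take k b.
Proof.
move=> kb; apply: (@eq_from_nth _ false).
  by rewrite size_mkseq size_takel.
move=> i; rewrite size_mkseq => ik; rewrite nth_mkseq // nth_take //.
by rewrite /prepend (leq_trans ik kb).
Qed.

Lemma starts_prepend a b w :
  size a <= size b -> starts a (prepend b w) = prefix a b.
Proof. by move=> ab; rewrite /starts mkseq_prepend // prefixE. Qed.

Lemma starts_self a w : starts a (prepend a w).
Proof. by rewrite starts_prepend // prefix_refl. Qed.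

Lemma startsP a w : reflect (exists v, w = prepend a v) (starts a w).
Proof.
apply: (iffP idP) => [/prepend_shift <-|[v ->]]; last exact: starts_self.
by eexists.
Qed.

Lemma starts_comparable a b w :
  starts a w -> starts b w -> size a <= size b -> prefix a b.
Proof. by move=> aw /startsP[v Ew] ab; rewrite Ew starts_prepend in aw. Qed.

Lemma starts_prefix a b w : prefix a b -> starts b w -> starts a w.
Proof.
move=> ab /startsP[v ->]; rewrite starts_prepend //; exact: size_prefix.
Qed.

Lemma incomp_sym a b : incomp a b = incomp b a.
Proof. by rewrite /incomp orbC. Qed.

Lemma incomp_starts a b w : incomp a b -> starts a w -> starts b w = false.
Proof.
move=> ab aw; apply: contraNF ab => bw; apply/orP.
by case: (leqP (size a) (size b)) => [|/ltnW] ?; [left|right];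
  apply: starts_comparable; eassumption.
Qed.

Lemma incomp_prepend a b w : incomp a b -> starts a (prepend b w) = false.
Proof. by rewrite incomp_sym => /incomp_starts; apply; exact: starts_self. Qed.

Lemma incompP a b :
  (forall w, starts a w -> starts b w -> False) -> incomp a b.
Proof.
move=> ab; apply/norP; split; apply/negP => /prefixP[c E].
  apply: (ab (prepend b (fun=> false))); last exact: starts_self.
  by rewrite E prepend_cat starts_self.
apply: (ab (prepend a (fun=> false))); first exact: starts_self.
by rewrite E prepend_cat starts_self.
Qed.

Lemma incomp_cat a b c d : incomp a b -> incomp (a ++ c) (b ++ d).
Proof.
move=> ab; apply: incompP => w /startsP[v ->] /startsP[u].
rewrite !prepend_cat => E; have := starts_self a (prepend c v).
by rewrite E incomp_prepend.
Qed.

Lemma incomp_catr a b c : incomp a b -> incomp a (b ++ c).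
Proof. by move/(incomp_cat [::] c); rewrite cats0. Qed.

Lemma incomp_catl a b c : incomp a b -> incomp (a ++ c) b.
Proof. by move/(incomp_cat c [::]); rewrite cats0. Qed.

Lemma incomp_cat2l a b c : incomp (a ++ b) (a ++ c) = incomp b c.
Proof. by rewrite /incomp !prefix_catr // eqxx. Qed.

Lemma incomp_long a x : size a <= size x -> ~~ prefix a x -> incomp a x.
Proof.
move=> ax nax; apply: incompP => w /starts_comparable aw /aw - /(_ ax).
exact/negP.
Qed.

Lemma prepend_inj a : injective (prepend a).
Proof. by move=> v w E; rewrite -(shift_prepend a v) E shift_prepend. Qed.

Lemma prepend_injl a b : (forall w, prepend a w = prepend b w) -> a = b.
Proof.
wlog ab : a b / size a <= size b.
  move=> W E; case: (leqP (size a) (size b)) => [|/ltnW] /W; first exact.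
  by move=> ->.
move=> E.
have [c Eb] : exists c, b = a ++ c.
  by apply/prefixP; rewrite -(starts_prepend (fun=> false) ab) -E starts_self.
case: c Eb => [|i c] Eb; first by rewrite Eb cats0.
(* The constant word with letters [~~ i] differs from every word that begins with [i]. *)
have := E (fun=> ~~ i); rewrite Eb prepend_cat => /prepend_inj.
by move/(congr1 (fun f => f 0)); rewrite /prepend /=; case: (i).
Qed.

(** * Partial action on addresses *)

Lemma image_cat g a b c :
  address_image g a b -> address_image g (a ++ c) (b ++ c).
Proof. by move=> gab w; rewrite !prepend_cat gab. Qed.

Lemma image_fun g a b c : address_image g a b -> address_image g a c -> b = c.
Proof. by move=> gb gc; apply: prepend_injl => w; rewrite -gb. Qed.

Lemma image_comp g h a b c :
  address_image g a b -> address_image h b c -> address_image (h \o g) a c.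
Proof. by move=> gab hbc w; rewrite /= gab hbc. Qed.

Lemma image_can g h a b :
  cancel g h -> address_image g a b -> address_image h b a.
Proof. by move=> gK gab w; rewrite -gab gK. Qed.

Lemma image_incomp g a b a' b' : injective g ->
  address_image g a a' -> address_image g b b' -> incomp a b -> incomp a' b'.
Proof.
move=> gI ga gb ab; apply: incompP => w /startsP[u ->] /startsP[v].
rewrite -ga -gb => /gI E.
by have := starts_self a u; rewrite E incomp_prepend.
Qed.

(** * Thompson's group V *)

(** Surjectivity holds because the cones of [b] cover, injectivity because those of [a] cover and
    those of [b] are disjoint. The inverse exchanges the two partitions. *)
Lemma thompsonV_bij g : thompsonV g ->
  exists h, [/\ cancel g h, cancel h g & thompsonV h].
Proof.
case=> n [a [b [[aU aT aN] [bU bT bN] gab]]].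
have gS w : exists v, g v = w.
  have : setT w by []. rewrite -bU => -[i _ [v _ <-]].
  by exists (prepend (a i) v).
have [h hK] := choice gS.
have gI : injective g.
  move=> v w.
  have : setT v by []. rewrite -{1}aU => -[i _ [v' _ <-]].
  have : setT w by []. rewrite -{1}aU => -[j _ [w' _ <-]].
  rewrite !gab => E.
  have Eij : i = j.
    by apply: bT => //; exists (prepend (b i) v'); split;
      [exists v'|exists w'].
  by rewrite Eij in E *; rewrite (prepend_inj E).
have gK : cancel g h by move=> w; apply: gI; rewrite hK.
exists h; split => //; exists n, b, a; split => // i w.
by rewrite -gab gK.
Qed.

(** An address as long as every [a i] lies below one of them. The size bound guarantees that
    sufficiently deep addresses have deep images. *)
Lemma thompsonV_image g : thompsonV g ->
  exists N, forall a, N <= size a ->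
    exists2 b, size a <= size b + N & address_image g a b.
Proof.
case=> n [a [b [[aU _ _] _ gab]]].
exists (\max_(i < n) size (a i)) => x xN.
have : setT (prepend x (fun=> false)) by [].
rewrite -aU => -[i _ [v _ E]].
have ix : size (a i) <= \max_(i < n) size (a i) by exact: leq_bigmax.
have /prefixP[c Ec] : prefix (a i) x.
  by rewrite -(starts_prepend (fun=> false) (leq_trans ix xN)) -E starts_self.
exists (b i ++ c); last by rewrite Ec; apply: image_cat => w; exact: gab.
by rewrite Ec !size_cat addnAC leq_add2r (leq_trans ix) // leq_addl.
Qed.

(** All addresses of length [N] form the first partition; since [g] is invertible, their images form
    the second. *)
Lemma thompsonV_intro g h N : cancel g h -> cancel h g ->
  (forall a, size a = N -> exists b, address_image g a b) -> thompsonV g.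
Proof.
move=> gK hK gN.
have fE (a : N.-tuple bool) : exists b, address_image g a b.
  by apply: gN; rewrite size_tuple.
have [f fP] := choice fE.
pose a (i : 'I_#|{: N.-tuple bool}|) : address := (enum_val i : N.-tuple bool).
pose b (i : 'I_#|{: N.-tuple bool}|) : address := f (enum_val i).
have gab i : address_image g (a i) (b i) by exact: fP.
have sa i : size (a i) = N by rewrite size_tuple.
have aT i j w : starts (a i) w -> starts (a j) w -> i = j.
  rewrite /starts !sa => /eqP Ei /eqP; rewrite Ei => E.
  by apply/enum_val_inj/val_inj.
have aU w : exists i v, w = prepend (a i) v.
  exists (enum_rank (mktuple (fun i : 'I_N => w i))).
  apply/startsP; rewrite /starts sa /a enum_rankK /=.
  by rewrite /mkseq -val_enum_ord -map_comp.
exists _, a, b; split => //; split.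
- rewrite eqEsubset; split=> // w _; have [i [v ->]] := aU w.
  by exists i => //; exists v.
- move=> i j _ _ [w [[u _ <-] [v _ E]]].
  by apply: (aT i j _ (starts_self _ u)); rewrite -E starts_self.
- by move=> i _; exists (prepend (a i) (fun=> false)); eexists.
- rewrite eqEsubset; split=> // w _; have [i [v E]] := aU (h w).
  by exists i => //; exists v => //; rewrite -gab -E hK.
- move=> i j _ _ [w [[u _ <-] [v _]]]; rewrite -!gab => /(can_inj gK) E.
  by apply: (aT i j _ (starts_self _ u)); rewrite -E starts_self.
- by move=> i _; exists (prepend (b i) (fun=> false)); eexists.
Qed.

(** * Swaps of incomparable cones *)

Definition swap (a b : address) (w : cantor) : cantor :=
  if starts a w then prepend b (shift (size a) w)
  else if starts b w then prepend a (shift (size b) w) else w.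

Lemma swap_imagel a b : address_image (swap a b) a b.
Proof. by move=> w; rewrite /swap starts_self shift_prepend. Qed.

Lemma swap_imager a b : incomp a b -> address_image (swap a b) b a.
Proof.
by move=> ab w; rewrite /swap incomp_prepend // starts_self shift_prepend.
Qed.

Lemma swap_out a b w : ~~ starts a w -> ~~ starts b w -> swap a b w = w.
Proof. by rewrite /swap => /negbTE-> /negbTE->. Qed.

Lemma swap_image_out a b c :
  incomp a c -> incomp b c -> address_image (swap a b) c c.
Proof. by move=> ac bc w; rewrite swap_out // incomp_prepend. Qed.

(** An address this long is no proper prefix of [a] or [b], so its cone lies inside one of the two
    cones or avoids both. *)
Lemma swap_image_long a b c : incomp a b -> maxn (size a) (size b) <= size c ->
  [\/ exists2 d, c = a ++ d & address_image (swap a b) c (b ++ d),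
      exists2 d, c = b ++ d & address_image (swap a b) c (a ++ d) |
      address_image (swap a b) c c].
Proof.
rewrite geq_max => ab /andP[ac bc].
have [/prefixP[d ->]|nac] := boolP (prefix a c).
  by constructor 1; exists d => //; apply/image_cat/swap_imagel.
have [/prefixP[d ->]|nbc] := boolP (prefix b c).
  by constructor 2; exists d => //; apply/image_cat/swap_imager.
by constructor 3; apply: swap_image_out; apply: incomp_long.
Qed.

Variant swap_spec a b w : cantor -> Prop :=
| SwapL v of w = prepend a v : swap_spec a b w (prepend b v)
| SwapR v of w = prepend b v : swap_spec a b w (prepend a v)
| SwapOut of ~~ starts a w & ~~ starts b w : swap_spec a b w w.

Lemma swapP a b w : swap_spec a b w (swap a b w).
Proof.
rewrite /swap; case: (boolP (starts a w)) => [/prepend_shift E|na].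
  exact: SwapL.
case: (boolP (starts b w)) => [/prepend_shift E|nb]; first exact: SwapR.
exact: SwapOut.
Qed.

Lemma swapC a b : incomp a b -> swap a b = swap b a.
Proof.
move=> ab; apply: funext => w; case: (swapP a b w) => [v ->|v ->|na nb].
- by rewrite swap_imager // incomp_sym.
- by rewrite swap_imagel.
- by rewrite swap_out.
Qed.

Lemma swapK a b : incomp a b -> involutive (swap a b).
Proof.
move=> ab w; case: {2}(swapP a b w) => [v ->|v ->|na nb].
- exact: swap_imager.
- exact: swap_imagel.
- exact: swap_out.
Qed.

(** Conjugation moves the exchanged cones to their images; a point outside these is pulled back by
    [h'] to a fixed point of [swap a b]. *)
Lemma swap_conj h h' a b a' b' : cancel h h' -> cancel h' h -> incomp a b ->
  address_image h a a' -> address_image h b b' ->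
  h \o swap a b \o h' = swap a' b'.
Proof.
move=> hK h'K ab ha hb.
have ab' := image_incomp (can_inj hK) ha hb ab.
apply: funext => w /=.
case: (swapP a' b' w) => [v ->|v ->|na nb].
- by rewrite -ha hK swap_imagel hb.
- by rewrite -hb hK swap_imager // ha.
- rewrite swap_out ?h'K //.
    by apply: contra na => /startsP[v E]; apply/startsP; exists v; rewrite -ha -E.
  by apply: contra nb => /startsP[v E]; apply/startsP; exists v; rewrite -hb -E.
Qed.

Lemma swap_thompsonV a b : incomp a b -> thompsonV (swap a b).
Proof.
move=> ab; have K := swapK ab.
apply: (thompsonV_intro (N := maxn (size a) (size b)) K K) => c cN.
have := @swap_image_long a b c ab; rewrite cN leqnn => /(_ isT).
by case=> [[d _ ?]|[d _ ?]|?]; eexists; eassumption.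
Qed.

(** Iterating this recovers a swap from the swaps at any fixed depth below [a] and [b]. *)
Lemma swap_children a b : incomp a b ->
  swap a b = swap (rcons a false) (rcons b false) \o
             swap (rcons a true) (rcons b true).
Proof.
move=> ab; rewrite -!cats1.
have ba : incomp b a by rewrite incomp_sym.
have I i j := (incomp_cat [:: i] [:: j] ab, incomp_cat [:: i] [:: j] ba).
have aa c i j : i != j -> incomp (c ++ [:: i]) (c ++ [:: j]).
  by rewrite incomp_cat2l; case: i; case: j.
have bit w : w = prepend [:: w 0] (shift 1 w).
  by rewrite prepend_shift // /starts /mkseq.
apply: funext => w /=.
case: (swapP a b w) => [v ->|v ->|na nb].
- rewrite [v]bit -!prepend_cat; case: (v 0).
  + by rewrite swap_imagel swap_image_out ?aa ?I.
  + by rewrite swap_image_out ?swap_imagel ?aa ?I.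
- rewrite [v]bit -!prepend_cat; case: (v 0).
  + by rewrite swap_imager ?I // swap_image_out ?aa ?I.
  + by rewrite swap_image_out ?swap_imager ?aa ?I.
- have na' i : ~~ starts (a ++ [:: i]) w.
    by apply: contra na; apply: starts_prefix; exact: prefix_prefix.
  have nb' i : ~~ starts (b ++ [:: i]) w.
    by apply: contra nb; apply: starts_prefix; exact: prefix_prefix.
  by rewrite !swap_out.
Qed.

(** * Generation by swaps *)

Section Generation.
Variable H : set (cantor -> cantor).
Hypothesis H_id : H id.
Hypothesis H_comp : forall f g, H f -> H g -> H (g \o f).
Hypothesis H_swap : forall a b, incomp a b -> H (swap a b).

(** The cones of [l] partition Cantor space; counting with multiplicity also excludes repeated
    addresses. *)
Definition prefix_code (l : seq address) : Prop :=
  forall w, count (fun a => starts a w) l = 1.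

Lemma prefix_code_perm l l' :
  perm_eq l l' -> prefix_code l -> prefix_code l'.
Proof. by move=> /permP E lP w; rewrite -E. Qed.

Lemma prefix_code_starts l a b w : prefix_code l -> a \in l -> b \in l ->
  starts a w -> starts b w -> a = b.
Proof.
move=> lP al bl aw bw; have := lP w.
rewrite (permP (perm_to_rem al)) /= aw => -[/eqP].
rewrite -leqn0 leqNgt -has_count => nh.
move: bl; rewrite (perm_mem (perm_to_rem al)) inE => /orP[/eqP //|br].
by case/negP: nh; apply/hasP; exists b.
Qed.

Lemma prefix_code_uniq l : prefix_code l -> uniq l.
Proof.
move=> lP; apply: count_mem_uniq => a.
case: (boolP (a \in l)) => [al|/count_memPn //].
apply/eqP; rewrite eqn_leq -has_count has_pred1 al andbT.
rewrite /= -(lP (prepend a (fun=> false))).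
by apply: sub_count => b /eqP->; exact: starts_self.
Qed.

Lemma prefix_code_incomp l a b :
  prefix_code l -> a \in l -> b \in l -> a != b -> incomp a b.
Proof.
move=> lP al bl ab; apply: incompP => w aw bw.
by move/eqP: ab; apply; exact: prefix_code_starts aw bw.
Qed.

(** Take a longest codeword [rcons p i] and the codeword [b] covering a point below its sibling. By
    maximality [b] is no longer than the sibling; were it shorter, it would also be a prefix of
    [rcons p i], against disjointness. *)
Lemma prefix_code_siblings l : prefix_code l -> 1 < size l ->
  exists p, rcons p false \in l /\ rcons p true \in l.
Proof.
move=> lP sl.
have [a al amax] : exists2 a, a \in l & forall b, b \in l -> size b <= size a.
  case: l sl {lP} => [//|x l _]; elim: l x => [|y l IH] x.
    by exists x; rewrite ?inE // => b; rewrite inE => /eqP->.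
  have [a al amax] := IH y.
  case: (leqP (size a) (size x)) => xa.
    exists x; first exact: mem_head.
    move=> b; rewrite inE => /orP[/eqP -> //|/amax ba].
    exact: leq_trans ba xa.
  exists a; first by rewrite inE al orbT.
  by move=> b; rewrite inE => /orP[/eqP ->|/amax //]; exact: ltnW.
case: (lastP a) al amax => [|p i] al amax.
  have l0 b : b \in l -> b = [::].
    by move=> /amax; rewrite leqn0 => /nilP.
  move: (prefix_code_uniq lP) l0; case: (l) sl => [|x [|y l']] //= _.
  rewrite inE negb_or => /andP[/andP[/eqP xy _] _] l0.
  have yl : y \in x :: y :: l' by rewrite !inE eqxx orbT.
  by case: xy; rewrite (l0 x (mem_head _ _)) (l0 y yl).
set w := prepend (rcons p (~~ i)) (fun=> false).
have /hasP[b bl bw] : has (fun a => starts a w) l by rewrite has_count lP.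
have bi : size b <= size (rcons p (~~ i)).
  by rewrite size_rcons -(size_rcons p i) amax.
have bp : prefix b (rcons p (~~ i)) by rewrite -(starts_prepend (fun=> false)).
have Eb : b = rcons p (~~ i).
  apply/eqP; move: bp; rewrite prefixE.
  move: bi; rewrite leq_eqVlt => /orP[/eqP -> |]; first by rewrite take_size eq_sym.
  rewrite size_rcons ltnS -cats1 => bp; rewrite takel_cat // => Eb.
  have bp' : prefix b (rcons p i).
    by rewrite -cats1 prefix_catl // prefixE.
  have bE := prefix_code_starts lP bl al _ (starts_self _ (fun=> false)).
  move: bp; rewrite bE ?size_rcons ?ltnn //.
  by rewrite starts_prepend // size_prefix.
by exists p; rewrite Eb in bl; case: (i) al bl.
Qed.

(** The list form of a tree pair diagram for [g]. *)
Definition table (g : cantor -> cantor) (L : seq (address * address)) : Prop :=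
  [/\ prefix_code (unzip1 L), prefix_code (unzip2 L) &
      forall x, x \in L -> address_image g x.1 x.2].

Definition transpose (b c x : address) : address :=
  if x == b then c else if x == c then b else x.

Lemma transposeK b c : involutive (transpose b c).
Proof.
move=> x; rewrite /transpose; case: (eqVneq x b) => [->|xb].
  by case: (eqVneq c b) => [//|_]; rewrite eqxx.
case: (eqVneq x c) => [->|xc]; first by rewrite eqxx.
by rewrite (negbTE xb) (negbTE xc).
Qed.

Definition retarget b c (L : seq (address * address)) :=
  [seq (x.1, transpose b c x.2) | x <- L].

Lemma retarget_mem b c L x y :
  (x, y) \in L -> (x, transpose b c y) \in retarget b c L.
Proof. by move=> xy; apply/mapP; exists (x, y). Qed.

Lemma retarget_perm b c L : uniq (unzip2 L) ->
  b \in unzip2 L -> c \in unzip2 L ->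
  perm_eq (unzip2 L) (unzip2 (retarget b c L)).
Proof.
move=> uL bL cL; have tI := can_inj (transposeK b c).
have -> : unzip2 (retarget b c L) = map (transpose b c) (unzip2 L).
  by rewrite /unzip2 -!map_comp.
apply: uniq_perm => [//||x]; first by rewrite (map_inj_uniq tI).
rewrite -{2}(transposeK b c x) mem_map // /transpose.
by case: eqVneq => [->|_]; [|case: eqVneq => [->|//]]; rewrite bL cL.
Qed.

(** Composing [g] with [swap b c] transposes [b] and [c] in the target column. The swap is an
    involution in [H], so it can be undone inside [H]. *)
Lemma table_retarget L b c : b \in unzip2 L -> c \in unzip2 L ->
  (forall g, table g (retarget b c L) -> H g) -> forall g, table g L -> H g.
Proof.
move=> bL cL HL g [P1 P2 gL]; case: (eqVneq b c) => bc.
  apply: HL; rewrite bc (_ : retarget _ _ _ = L) //.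
  rewrite /retarget -[RHS]map_id; apply: eq_map => -[x y] /=.
  by rewrite /transpose; case: (eqVneq y c) => [->|].
have bci := prefix_code_incomp P2 bL cL bc.
rewrite (_ : g = swap b c \o (swap b c \o g)); last first.
  by apply: funext => w /=; rewrite swapK.
apply: H_comp; last exact: H_swap.
apply: HL; split.
- by have -> : unzip1 (retarget b c L) = unzip1 L by rewrite /unzip1 -map_comp.
- apply: (prefix_code_perm _ P2); apply: retarget_perm => //.
  exact: prefix_code_uniq.
- move=> _ /mapP[[x y] xyL ->] /=; apply: image_comp (gL _ xyL) _ => /=.
  have yL : y \in unzip2 L by apply/mapP; exists (x, y).
  rewrite /transpose; case: eqVneq => [->|yb]; first exact: swap_imagel.
  case: eqVneq => [->|yc]; first exact: swap_imager.
  by apply: swap_image_out; apply: (prefix_code_incomp P2);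
    rewrite // eq_sym.
Qed.

(** A word in the cone of [p] starts with exactly one child of [p], and any other word with
    neither. *)
Lemma prefix_code_merge p l :
  prefix_code (rcons p false :: rcons p true :: l) -> prefix_code (p :: l).
Proof.
move=> lP w; rewrite -(lP w) /= addnA; congr (_ + _).
case: (boolP (starts p w)) => [/startsP[v ->]|np].
  have bit : v = prepend [:: v 0] (shift 1 v).
    by rewrite prepend_shift // /starts /mkseq.
  rewrite [v]bit -prepend_cat -!cats1.
  by case: (v 0); rewrite !starts_prepend ?size_cat // !prefix_catr // eqxx.
have n i : starts (rcons p i) w = false.
  apply: contraNF np; apply: starts_prefix; exact: prefix_rcons.
by rewrite !n.
Qed.

Lemma table_merge g p q L :
  table g ((rcons p false, rcons q false) :: (rcons p true, rcons q true) :: L)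
  -> table g ((p, q) :: L).
Proof.
case=> /prefix_code_merge P1 /prefix_code_merge P2 gL; split=> // x.
rewrite inE => /orP[/eqP ->|xL]; last by apply: gL; rewrite !inE xL !orbT.
have gi i : address_image g (rcons p i) (rcons q i).
  by case: i; [apply: (gL (rcons p true, rcons q true))|
    apply: (gL (rcons p false, rcons q false))]; rewrite !inE eqxx ?orbT.
move=> w; have bit : w = prepend [:: w 0] (shift 1 w).
  by rewrite prepend_shift // /starts /mkseq.
by rewrite /= [w]bit -!prepend_cat !cats1 gi.
Qed.

Lemma table_perm g L L' : perm_eq L L' -> table g L -> table g L'.
Proof.
move=> LL' [P1 P2 gL]; split=> [||x]; last by rewrite -(perm_mem LL'); exact: gL.
- by apply: prefix_code_perm P1; apply: perm_map.
- by apply: prefix_code_perm P2; apply: perm_map.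
Qed.

(* Permuting the targets by swaps brings the images of two sibling cones to
   sibling cones, after which the two rows of the table merge into one. *)
Lemma table_generated L g : table g L -> H g.
Proof.
elim/ltn_ind: {L}(size L) {-2}L (erefl (size L)) g => n IH L sL g gL.
have [P1 P2 _] := gL.
case: (ltnP 1 (size L)) => [L1|]; last first.
  case: L gL P1 {P2 sL} => [|[a b] [|//]] [_ P2 gL] P1 _.
    by have := P1 (fun=> false).
  (* The only row pairs the empty address with itself, so [g] is the identity: the cone of a
     nonempty [i :: x] misses the constant word with letters [~~ i]. *)
  have nilP x : prefix_code [:: x] -> x = [::].
    by case: x => [//|i x] /(_ (fun=> ~~ i)); rewrite /= /starts /=; case: i.
  rewrite (_ : g = id) //; apply: funext => w.
  have := gL (a, b); rewrite inE eqxx /= => /(_ isT w).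
  by rewrite (nilP a) // (nilP b) // !prepend_nil.
have [p [p0 p1]] := prefix_code_siblings P1 (etrans (congr1 _ (size_map _ _)) L1).
have [q [q0 q1]] := prefix_code_siblings P2 (etrans (congr1 _ (size_map _ _)) L1).
case/mapP: p0 => [[? b0] b0L /= E]; rewrite -{}E in b0L.
case/mapP: p1 => [[? b1] b1L /= E]; rewrite -{}E in b1L.
have mem2 x y M : (x, y) \in M -> y \in unzip2 M by move=> xy; apply/mapP; exists (x, y).
have siblings x : (rcons x false == rcons x true) = false.
  by apply/negP => /eqP/rcons_inj[].
(* The first transposition gives the row of [rcons p false] the target [rcons q false]. *)
move: g gL; apply: (@table_retarget L b0 (rcons q false)) => // [|g gL].
  exact: mem2 b0L.
set L' := retarget _ _ _ in gL.
have U' : perm_eq (unzip2 L) (unzip2 L').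
  by apply: (retarget_perm _ _ q0); [exact: prefix_code_uniq|exact: mem2 b0L].
have [P1' P2' _] := gL.
have := retarget_mem b0 (rcons q false) b0L.
rewrite {1}/transpose eqxx -/L' => q0L'.
have := retarget_mem b0 (rcons q false) b1L; rewrite -/L'.
move: (transpose _ _ _) => b1' b1L'.
have q1L' : rcons q true \in unzip2 L' by rewrite -(perm_mem U').
(* Targets do not repeat, so the second transposition, of [b1'] and [rcons q true], leaves the row
   of [rcons p false] as it is. *)
have nb1' : rcons q false != b1'.
  apply/eqP => E; rewrite -E in b1L'.
  have := prefix_code_uniq P2'.
  have /perm_to_rem U0 := q0L'; rewrite (perm_uniq (perm_map _ U0)) /=.
  case/andP => /negP[]; apply/mapP; exists (rcons p true, rcons q false) => //.
  by move: b1L'; rewrite (perm_mem U0) inE xpair_eqE [_ == rcons p _]eq_sym siblings.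
move: g gL; apply: (@table_retarget L' b1' (rcons q true)) => // [|g gL].
  exact: mem2 b1L'.
set L'' := retarget _ _ _ in gL.
have := retarget_mem b1' (rcons q true) b1L'.
rewrite {1}/transpose eqxx -/L'' => q1L''.
have := retarget_mem b1' (rcons q true) q0L'.
rewrite {1}/transpose (negbTE nb1') siblings -/L'' => q0L''.
have U0 := perm_to_rem q0L''.
have q1r : (rcons p true, rcons q true) \in rem (rcons p false, rcons q false) L''.
  by move: q1L''; rewrite (perm_mem U0) inE xpair_eqE [_ == rcons p _]eq_sym siblings.
have U1 : perm_eq L'' ((rcons p false, rcons q false) ::
    (rcons p true, rcons q true) ::
    rem (rcons p true, rcons q true) (rem (rcons p false, rcons q false) L'')).
  by apply: perm_trans U0 _; rewrite perm_cons perm_to_rem.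
have := table_merge (table_perm U1 gL); apply: IH (erefl _) _.
by move: (perm_size U1); rewrite !size_map sL /= => ->.
Qed.

Lemma thompsonV_generated : thompsonV `<=` H.
Proof.
move=> g [n [a [b [aP bP gab]]]].
have code (c : 'I_n -> address) : cone_partition c ->
    prefix_code (map c (enum 'I_n)).
  case=> cU cT _ w; have : setT w by []. 
  rewrite -cU => -[i _ [v _ <-]]; rewrite count_map.
  transitivity (count_mem i (enum 'I_n)); last first.
    by rewrite count_uniq_mem ?enum_uniq // mem_enum.
  apply: eq_count => j /=; apply/idP/eqP => [|->].
    move=> /startsP[u E]; apply: cT => //; exists (prepend (c i) v).
    by split; [exists u|exists v].
  exact: starts_self.
apply: (@table_generated [seq (a i, b i) | i <- enum 'I_n]); split.
- by rewrite /unzip1 -map_comp; exact: code.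
- by rewrite /unzip2 -map_comp; exact: code.
- by move=> _ /mapP[i _ ->] w /=; exact: gab.
Qed.
End Generation.

(** * Type systems *)

Section TypeSystem.
Variable P : type_system.

Lemma same_type_cat a b c : P a b -> P (a ++ c) (b ++ c).
Proof.
elim: c a b => [|i c IH] a b ab; first by rewrite !cats0.
by rewrite -!cat_rcons; apply: IH; case: i; case/same_type_children: ab.
Qed.

(** The type of an address is determined by those of its children, hence by those at any fixed
    depth. This allows every comparison of types to be moved arbitrarily deep. *)
Lemma same_type_lift n a b :
  (forall c, size c = n -> P (a ++ c) (b ++ c)) -> P a b.
Proof.
elim: n a b => [|n IH] a b ab; first by have := ab [::] erefl; rewrite !cats0.
by apply/same_type_children; split; apply: IH => c sc; rewrite !cat_rcons;
  apply: ab; rewrite /= sc.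
Qed.

Lemma type_ofE a b : type_of P a = type_of P b <-> P a b.
Proof.
split=> [E|ab].
  have : type_of P a a by exact: same_type_refl.
  by rewrite E => /same_type_sym.
apply/seteqP; split=> c; last exact: same_type_trans.
exact/same_type_trans/same_type_sym.
Qed.

End TypeSystem.

Lemma types_same (P Q : type_system) a b :
  types P = types Q -> P a b -> Q a b.
Proof.
move=> E ab; have : types P (type_of P a) by exists a.
rewrite E => -[c _ Ec].
have ca : type_of Q c a by rewrite Ec; exact: same_type_refl.
have cb : type_of Q c b by rewrite Ec.
exact/(same_type_trans (same_type_sym ca) cb).
Qed.

Lemma simple_quotient (P Q : type_system) : simple P -> quotient P Q ->
  (forall a b, Q a b -> P a b) \/ (forall a b, Q a b).
Proof.
move=> sP PQ; case: (pselect (types Q = types P)) => [E|NE].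
  by left=> a b; exact: types_same.
by right=> a b; have /sP E := conj PQ NE; apply: (types_same (esym E)).
Qed.

(** Simplicity makes the universal type system a proper quotient of [P], hence different from it. *)
Lemma simple_nonuniversal (P : type_system) :
  simple P -> exists a b, ~ P a b.
Proof.
move=> sP; have [_ NE] := (sP universal_type_system).2 erefl.
apply: contrapT => /forallNP U; apply: NE.
have {}U a : type_of P a = setT.
  by rewrite -subTset => b _; apply: contrapT => ab; apply: (U a); exists b.
by rewrite /types; congr (_ @` _); apply: funext => a; rewrite U -subTset.
Qed.

(** * Stabilizers: length thresholds and the subgroup property *)

Lemma finite_short N : finite_set [set a : address | size a < N].
Proof.
elim: N => [|N IH]; first by rewrite (_ : [set _ | _] = set0) // -subset0.
apply: (@sub_finite_set _ _ ([set [::]] `|` (cons true @` [set a | size a < N] `|`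
  cons false @` [set a : address | size a < N]))).
  move=> [|[] a] /= aN; [by left|right; left|right; right]; by exists a.
by rewrite !finite_setU; split; [exact: finite_set1|split; exact: finite_image].
Qed.

Lemma cofinite_long (A : set address) :
  finite_set (~` A) -> exists N, forall a, N <= size a -> A a.
Proof.
case/finite_seqP => s sA; exists (\max_(a <- s) size a).+1 => a aN.
apply: contrapT => nA; have : (~` A) a by [].
rewrite sA /= => a_s; move: aN; rewrite ltnNge.
by rewrite (leq_bigmax_seq (F := size) _ a_s).
Qed.

(** Cofinite sets become length thresholds: a cofinite set contains all long addresses, and all
    sufficiently long addresses form a cofinite set on which [g] is defined. *)
Lemma stabV_P (P : type_system) g : stabV P g <->
  thompsonV g /\ exists N, forall a b a' b', N <= size a -> N <= size b ->
    address_image g a a' -> address_image g b b' -> (P a b <-> P a' b').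
Proof.
split=> [[Vg [A [fA _ AP]]]|[Vg [N gN]]]; split=> //.
  have [N NA] := cofinite_long fA; exists N => a b a' b' /NA aN /NA bN.
  exact: AP.
have [N' gN'] := thompsonV_image Vg.
exists [set a | maxn N N' <= size a]; split.
- rewrite (_ : ~` _ = [set a | size a < maxn N N']); first exact: finite_short.
  by apply/seteqP; split=> a /=; rewrite ltnNge => /negP.
- by move=> a /=; rewrite geq_max => /andP[_ /gN'[b _ ?]]; exists b.
- move=> a b a' b' /=; rewrite !geq_max => /andP[aN _] /andP[bN _].
  exact: gN.
Qed.

Lemma thompsonV_id : thompsonV id.
Proof.
by apply: (@thompsonV_intro id id 0) => // a _; exists a.
Qed.

Lemma thompsonV_comp f g : thompsonV f -> thompsonV g -> thompsonV (g \o f).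
Proof.
move=> Vf Vg; have [f' [fK f'K _]] := thompsonV_bij Vf.
have [g' [gK g'K _]] := thompsonV_bij Vg.
have [Nf fN] := thompsonV_image Vf; have [Ng gN] := thompsonV_image Vg.
apply: (@thompsonV_intro _ (f' \o g') (Nf + Ng)).
- exact: can_comp.
- exact: can_comp.
- move=> a aN; have [|b ab fab] := fN a; first by rewrite aN leq_addr.
  have [|c _ gbc] := gN b; first by rewrite -(leq_add2r Nf) addnC -aN.
  by exists c; exact: image_comp gbc.
Qed.

Lemma stabV_subgroup (P : type_system) : is_subgroup thompsonV (stabV P).
Proof.
split.
- by move=> g [].
- apply/stabV_P; split; first exact: thompsonV_id.
  by exists 0 => a b a' b' _ _ /prepend_injl -> /prepend_injl ->.
- move=> f g /stabV_P[Vf [Nf fP]] /stabV_P[Vg [Ng gP]].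
  apply/stabV_P; split; first exact: thompsonV_comp.
  have [M fM] := thompsonV_image Vf.
  (* Since [f] shortens addresses by at most [M], the images under [f] still reach the threshold
     [Ng]. *)
  exists (maxn Nf (M + Ng)) => a b a' b'.
  rewrite !geq_max => /andP[aN aM] /andP[bN bM] ga gb.
  have [|x ax fx] := fM a; first exact: leq_trans (leq_addr _ _) aM.
  have [|y yb fy] := fM b; first exact: leq_trans (leq_addr _ _) bM.
  have Nx : Ng <= size x by rewrite -(leq_add2r M) addnC (leq_trans aM).
  have Ny : Ng <= size y by rewrite -(leq_add2r M) addnC (leq_trans bM).
  rewrite (fP _ _ _ _ aN bN fx fy); apply: gP => // w.
    by rewrite -fx -ga.
  by rewrite -fy -gb.
- move=> f g /stabV_P[Vf [Nf fP]] fK gK.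
  have [h [fK' _ Vh]] := thompsonV_bij Vf.
  have Eh : h = g by apply: funext => w; rewrite -{1}(gK w) fK'.
  rewrite Eh in Vh; apply/stabV_P; split=> //.
  have [M gM] := thompsonV_image Vh.
  (* Since [g] shortens addresses by at most [M], its images reach the threshold [Nf], where the
     property of [f] applies. *)
  exists (Nf + M) => a b a' b' aN bN ga gb.
  have long x y : Nf + M <= size x -> address_image g x y -> Nf <= size y.
    move=> xN gx; have [|z xz gz] := gM x; first exact: leq_trans (leq_addl _ _) xN.
    by rewrite (image_fun gx gz) -(leq_add2r M) (leq_trans xN).
  have := fP _ _ _ _ (long _ _ aN ga) (long _ _ bN gb)
    (image_can gK ga) (image_can gK gb).
  by move=> [? ?]; split.
Qed.

(** * Branching type systems *)

Definition self_branching (P : type_system) (t : nat) : Prop :=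
  forall a, t <= size a ->
    exists u v, [/\ incomp u v, P (a ++ u) a & P (a ++ v) a].

Section SelfBranchingCriteria.
Variable P : type_system.

(** Child-closure keeps both children in the nucleus, and strong connectedness leads from each of
    them back to the type of [a]. *)
Lemma nucleus_self_branching S a : nucleus P S -> S (type_of P a) ->
  exists u v, [/\ incomp u v, P (a ++ u) a & P (a ++ v) a].
Proof.
case=> _ _ cS sS Sa.
have return_ i : exists u, P (a ++ i :: u) a.
  have [u [_ Eu _]] := sS _ _ (cS _ Sa i) Sa; exists u.
  by apply/type_ofE; rewrite -Eu !descendant_type_of -catA.
have [u Pu] := return_ false; have [v Pv] := return_ true.
by exists (false :: u), (true :: v).
Qed.

Lemma multinuclear_self_branching :
  multinuclear P -> exists t, self_branching P t.
Proof.
case=> t [k [Q [_ _ nQ _ tQ]]]; exists t => a /tQ[i].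
exact: nucleus_self_branching.
Qed.

(** A type in [Q] leads to the branching type [X], whose two children lie in [Q] and so lead back. A
    type in [R] is covered by the nucleus case. *)
Lemma quasinuclear_self_branching t Q R :
  quasinuclear_with P t Q R -> branching P Q -> self_branching P t.
Proof.
move=> [_ [QP _ _ _ _] [tQR nR sQ _ _]] [X [QX QX0 QX1]] a /tQR[Qa|]; last first.
  exact: nucleus_self_branching.
have [c [_ Ec _]] := sQ _ _ Qa QX.
have return_ i : exists u, P (a ++ c ++ i :: u) a.
  have QXi : Q (descendant P X [:: i]) by case: i.
  have [u [_ Eu _]] := sQ _ _ QXi Qa; exists u.
  by apply/type_ofE; rewrite -Eu -Ec !descendant_type_of -!catA.
have [u Pu] := return_ false; have [v Pv] := return_ true.
by exists (c ++ false :: u), (c ++ true :: v); split; rewrite ?incomp_cat2l.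
Qed.

End SelfBranchingCriteria.

(** * Free room below an address, and properness of the stabilizer *)

Section Room.
Variables (P : type_system) (t : nat).
Hypothesis P_branching : self_branching P t.

(** Induction on [k]: a long address [x] can lie below at most one of two incomparable copies of
    [a]. Descend into the other copy and avoid the remaining addresses there. *)
Lemma room k a : t <= size a -> exists N, forall l : seq address,
  size l <= k -> {in l, forall x, N <= size x} ->
  exists2 u, P (a ++ u) a & {in l, forall x, incomp (a ++ u) x}.
Proof.
elim: k a => [|k IH] a ta.
  exists 0 => -[|//] _ _; exists [::] => //.
  by rewrite cats0; exact: same_type_refl.
have [u [v [uv Pu Pv]]] := P_branching ta.
have long z : t <= size (a ++ z) by rewrite size_cat (leq_trans ta) // leq_addr.
have [Nu NuP] := IH _ (long u); have [Nv NvP] := IH _ (long v).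
(* The first two bounds keep [x] from being a proper prefix of a copy; the last two serve the
   recursive calls. *)
exists (maxn (maxn (size (a ++ u)) (size (a ++ v))) (maxn Nu Nv)).
move=> [|x l] lk lN.
  by exists [::] => //; rewrite cats0; exact: same_type_refl.
have step z Nz : P (a ++ z) a -> Nz <= maxn Nu Nv -> incomp (a ++ z) x ->
    (forall l : seq address, size l <= k -> {in l, forall x, Nz <= size x} ->
      exists2 u, P ((a ++ z) ++ u) (a ++ z) &
        {in l, forall x, incomp ((a ++ z) ++ u) x}) ->
    exists2 u, P (a ++ u) a & {in x :: l, forall x, incomp (a ++ u) x}.
  move=> Pz NzN zx /(_ l lk)[y yl|w Pw wl].
    apply: leq_trans NzN _; have /lN : y \in x :: l by rewrite inE yl orbT.
    by rewrite geq_max => /andP[].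
  rewrite -catA in Pw wl; exists (z ++ w); first exact: same_type_trans Pz.
  move=> y; rewrite inE => /orP[/eqP ->|/wl //].
  by rewrite catA; exact: incomp_catl.
have := lN x (mem_head _ _); rewrite !geq_max => /andP[/andP[xu xv] _].
case: (boolP (prefix (a ++ u) x)) => xu'.
  apply: (step v Nv) => //; first exact: leq_maxr.
  case/prefixP: xu' => y ->; apply: incomp_catr.
  by rewrite incomp_cat2l incomp_sym.
by apply: (step u Nu) => //; [exact: leq_maxl|exact: incomp_long].
Qed.

(** Every address at least as long as [a] and [b] is sent to one of its own type. *)
Lemma stabV_swap a b : incomp a b -> P a b -> stabV P (swap a b).
Proof.
move=> ab Pab; apply/stabV_P; split; first exact: swap_thompsonV.
exists (maxn (size a) (size b)) => c d c' d' cN dN gc gd.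
have same x x' : maxn (size a) (size b) <= size x ->
    address_image (swap a b) x x' -> P x x'.
  move=> xN gx.
  case: (swap_image_long ab xN) => [[y Ex g]|[y Ex g]|g];
    rewrite (image_fun gx g) ?Ex.
  - exact: same_type_cat.
  - exact/same_type_cat/same_type_sym.
  - exact: same_type_refl.
have Pc := same _ _ cN gc; have Pd := same _ _ dN gd.
split=> [cd|cd].
  exact: same_type_trans (same_type_sym Pc) (same_type_trans cd Pd).
exact: same_type_trans Pc (same_type_trans cd (same_type_sym Pd)).
Qed.

(** Take two incomparable copies of [a], where [b] has a different type. The swap of one copy with
    [b] fixes the other, so it would separate two addresses of equal type. *)
Lemma stabV_proper : (exists a b, ~ P a b) -> stabV P <> thompsonV.
Proof.
case=> a [b nab] E.
have [c sc nabc] : exists2 c, size c = t & ~ P (a ++ c) (b ++ c).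
  apply: contrapT => N; apply: nab; apply: (@same_type_lift _ t) => c sc.
  by apply: contrapT => ?; apply: N; exists c.
have {sc} ta : t <= size (a ++ c) by rewrite size_cat sc leq_addl.
move: (a ++ c) (b ++ c) ta nabc => {a b nab c} a b ta nab.
have [N NP] := room 2 ta.
(* Some extension by [N] letters keeps the types different and makes the addresses long enough for
   [room]. *)
have [c sc nabc] : exists2 c, size c = N & ~ P (a ++ c) (b ++ c).
  apply: contrapT => NN; apply: nab; apply: (@same_type_lift _ N) => c sc.
  by apply: contrapT => ?; apply: NN; exists c.
have Nc x : N <= size (x ++ c) by rewrite size_cat sc leq_addl.
have [|u Pu /(_ _ (mem_head _ _)) ub] := NP [:: b ++ c] isT.
  by move=> x; rewrite inE => /eqP ->.
have [|v Pv vub] := NP [:: b ++ c; (a ++ u) ++ c] isT.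
  by move=> x; rewrite !inE => /orP[] /eqP ->.
have vb : incomp ((a ++ v) ++ c) (b ++ c).
  by apply: incomp_catl; apply: vub; rewrite !inE eqxx.
have uv : incomp ((a ++ v) ++ c) ((a ++ u) ++ c).
  by apply: incomp_catl; apply: vub; rewrite !inE eqxx orbT.
have : stabV P (swap ((a ++ v) ++ c) (b ++ c)) by rewrite E; exact: swap_thompsonV.
case/stabV_P => _ [M MP].
apply: nabc; apply: same_type_trans (same_type_cat c (same_type_sym Pu)) _.
apply: (@same_type_lift _ M) => d sd.
have Md x : M <= size (x ++ d) by rewrite size_cat sd leq_addl.
apply/(MP _ _ _ _ (Md ((a ++ u) ++ c)) (Md ((a ++ v) ++ c))).
- apply: image_cat; apply: swap_image_out => //.
  by rewrite incomp_sym; exact: incomp_catl.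
- exact/image_cat/swap_imagel.
- apply/same_type_cat/same_type_cat.
  exact: same_type_trans Pu (same_type_sym Pv).
Qed.

End Room.

(** * Overgroups of the stabilizer *)

Section Overgroup.
Variables (P : type_system) (t : nat) (H : set (cantor -> cantor)).
Hypothesis P_branching : self_branching P t.
Hypothesis H_subgroup : is_subgroup thompsonV H.
Hypothesis stabH : stabV P `<=` H.

(* Quantifying over [c] is needed: unlike the relation [H (swap a b)], this one
   passes to descendants. *)
Definition swappable (a b : address) : Prop :=
  incomp a b /\ forall c, H (swap (a ++ c) (b ++ c)).

(** The middle address [e], which may depend on [c], allows comparable and even equal addresses to
    be linked. *)
Definition linked (a b : address) : Prop :=
  exists n, forall c, size c = n ->
    exists e, swappable (a ++ c) e /\ swappable e (b ++ c).

Lemma swappable_cat a b c : swappable a b -> swappable (a ++ c) (b ++ c).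
Proof.
case=> ab abH; split; first exact: incomp_cat.
by move=> d; rewrite -!catA.
Qed.

Lemma swappable_sym a b : swappable a b -> swappable b a.
Proof.
case=> ab abH; split=> [|c]; first by rewrite incomp_sym.
by rewrite swapC //; apply: incomp_cat; rewrite incomp_sym.
Qed.

(** Conjugating the swap of [a] and [b] by that of [b] and [c] gives the swap of [a] and [c], as the
    second one fixes the cone of [a]. *)
Lemma swappable_trans a b c :
  incomp a c -> swappable a b -> swappable b c -> swappable a c.
Proof.
move=> ac [ab abH] [bc bcH]; split=> // d.
have bcd := incomp_cat d d bc; have acd := incomp_cat d d ac.
have [_ _ Hcomp _] := H_subgroup.
have K := swapK bcd.
rewrite -(@swap_conj _ _ (a ++ d) (b ++ d) _ _ K K) //.
- by apply: (Hcomp); [exact: bcH|apply: (Hcomp); [exact: abH|exact: bcH]].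
- exact: incomp_cat.
- by apply: swap_image_out; rewrite incomp_sym //; exact: incomp_cat.
- exact: swap_imagel.
Qed.

Lemma same_type_swappable a b : incomp a b -> P a b -> swappable a b.
Proof.
move=> ab Pab; split=> // c; apply: stabH.
by apply: stabV_swap; [exact: incomp_cat|exact: same_type_cat].
Qed.

(** Chains extend to all greater depths by [swappable_cat], so the depths found for the two children
    can be padded to a common one. *)
Lemma linked_lift n a b :
  (forall c, size c = n -> linked (a ++ c) (b ++ c)) -> linked a b.
Proof.
elim: n a b => [|n IH] a b ab; first by have := ab [::] erefl; rewrite !cats0.
have child i : linked (a ++ [:: i]) (b ++ [:: i]).
  by apply: IH => c sc; rewrite -!catA; apply: ab; rewrite /= sc.
have [[n0 n0P] [n1 n1P]] := (child false, child true).
have pad i m (mP : forall c, size c = m -> exists e,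
     swappable ((a ++ [:: i]) ++ c) e /\ swappable e ((b ++ [:: i]) ++ c))
    c : m <= size c ->
    exists e, swappable (a ++ i :: c) e /\ swappable e (b ++ i :: c).
  move=> mc; have [|e [ae eb]] := mP (take m c); first by rewrite size_takel.
  exists (e ++ drop m c).
  have E x : x ++ i :: c = ((x ++ [:: i]) ++ take m c) ++ drop m c.
    by rewrite -!catA /= cat_take_drop.
  by rewrite !E; split; exact: swappable_cat.
exists (maxn n0 n1).+1 => -[|i c] //= [sc].
case: i.
  by apply: (pad _ _ n1P); rewrite sc leq_maxr.
by apply: (pad _ _ n0P); rewrite sc leq_maxl.
Qed.

Lemma linked_cat a b c : linked a b -> linked (a ++ c) (b ++ c).
Proof.
case=> n nP; exists n => d sd.
have [|e [ae eb]] := nP (take n (c ++ d)).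
  by rewrite size_takel // size_cat sd leq_addl.
exists (e ++ drop n (c ++ d)).
have E x : (x ++ c) ++ d = (x ++ take n (c ++ d)) ++ drop n (c ++ d).
  by rewrite -!catA cat_take_drop.
by rewrite !E; split; exact: swappable_cat.
Qed.

Lemma linked_deep a b :
  (forall c, t <= size (a ++ c) -> linked (a ++ c) (b ++ c)) -> linked a b.
Proof.
move=> ab; apply: (@linked_lift t) => c sc.
by apply: ab; rewrite size_cat sc leq_addl.
Qed.

(** At depth [n] the chains collapse by [swappable_trans], since the endpoints are incomparable;
    [swap_children] then reassembles the swap. *)
Lemma linked_swap a b : incomp a b -> linked a b -> H (swap a b).
Proof.
have [_ _ Hcomp _] := H_subgroup.
move=> ab [n nP].
have {nP} : forall c, size c = n -> H (swap (a ++ c) (b ++ c)).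
  move=> c /nP[e [ae eb]].
  have [_ /(_ [::])] := swappable_trans (incomp_cat c c ab) ae eb.
  by rewrite !cats0.
elim: n a b ab => [|n IH] a b ab nP; first by have := nP [::] erefl; rewrite !cats0.
rewrite swap_children //; apply: Hcomp; apply: IH.
- by rewrite -!cats1; exact: incomp_cat.
- by move=> c sc; rewrite !cat_rcons; apply: nP; rewrite /= sc.
- by rewrite -!cats1; exact: incomp_cat.
- by move=> c sc; rewrite !cat_rcons; apply: nP; rewrite /= sc.
Qed.

(** The middle address is a copy of [a] placed clear of both endpoints. *)
Lemma same_type_linked a b : P a b -> linked a b.
Proof.
move=> Pab; apply: linked_deep => c; move/(same_type_cat c): Pab.
move: (a ++ c) (b ++ c) => {}a {}b Pab ta.
have [N NP] := room P_branching 2 ta; exists N => d sd.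
have [|u Pu ul] := NP [:: a ++ d; b ++ d] isT.
  by move=> x; rewrite !inE => /orP[] /eqP ->; rewrite size_cat sd leq_addl.
exists ((a ++ u) ++ d); split.
  apply: same_type_swappable; last exact/same_type_cat/same_type_sym.
  by rewrite incomp_sym; apply: incomp_catl; apply: ul; rewrite !inE eqxx.
apply: same_type_swappable; last exact/same_type_cat/(same_type_trans Pu).
by apply: incomp_catl; apply: ul; rewrite !inE eqxx orbT.
Qed.

Lemma linked_refl a : linked a a.
Proof. exact/same_type_linked/same_type_refl. Qed.

Lemma linked_sym a b : linked a b -> linked b a.
Proof.
case=> n nP; exists n => c /nP[e [ae eb]].
by exists e; split; exact: swappable_sym.
Qed.

(** Deep enough there is a chain [a], [e], [b], [f], [c]. A copy [g] of [b] incomparable with all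
    five is swappable with [b], hence with [e] and [f], hence with [a] and [c]; so [a], [g], [c] is
    a chain. *)
Lemma linked_trans a b c : linked a b -> linked b c -> linked a c.
Proof.
move=> ab bc; apply: (@linked_lift t) => d sd.
have tb : t <= size (b ++ d) by rewrite size_cat sd leq_addl.
move/(linked_cat d): ab; move/(linked_cat d): bc; move: tb.
move: (a ++ d) (b ++ d) (c ++ d) => {d sd}a {}b {}c tb bc [n nP].
apply: (@linked_lift n) => d sd.
have {nP sd} [e [ae eb]] := nP _ sd.
have {}tb : t <= size (b ++ d) by rewrite size_cat (leq_trans tb) // leq_addr.
move/(linked_cat d): bc; move: tb ae eb.
move: (a ++ d) (b ++ d) (c ++ d) => {d}a {}b {}c tb ae eb [n' nP].
apply: (@linked_lift n') => d sd.
have {nP sd} [f [bf fc]] := nP _ sd.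
have {}tb : t <= size (b ++ d) by rewrite size_cat (leq_trans tb) // leq_addr.
move/(swappable_cat d): ae; move/(swappable_cat d): eb; move: tb bf fc.
move: (a ++ d) (b ++ d) (c ++ d) (e ++ d) => {d}a {}b {}c {}e tb bf fc eb ae.
have [N NP] := room P_branching 5 tb; exists N => d sd.
have [|u Pu ul] := NP [seq x ++ d | x <- [:: a; b; c; e; f]] isT.
  by move=> _ /mapP[x _ ->]; rewrite size_cat sd leq_addl.
pose g := (b ++ u) ++ d.
have gi x : x \in [:: a; b; c; e; f] -> incomp g (x ++ d).
  by move=> xl; apply: incomp_catl; apply: ul; exact: (map_f (fun y => y ++ d)) xl.
have bg : swappable (b ++ d) g.
  apply: same_type_swappable; last exact/same_type_cat/same_type_sym.
  by rewrite incomp_sym gi // !inE eqxx ?orbT.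
exists g; split.
  apply: (@swappable_trans _ (e ++ d)); last apply: (@swappable_trans _ (b ++ d)) bg.
  - by rewrite incomp_sym gi // !inE eqxx ?orbT.
  - exact: swappable_cat.
  - by rewrite incomp_sym gi // !inE eqxx ?orbT.
  - exact: swappable_cat.
apply: (@swappable_trans _ (f ++ d)); last exact: swappable_cat.
  by rewrite gi // !inE eqxx ?orbT.
apply: swappable_trans (swappable_sym bg) _; last exact: swappable_cat.
by rewrite gi // !inE eqxx ?orbT.
Qed.

Lemma linked_children a b : linked a b <->
  linked (rcons a false) (rcons b false) /\ linked (rcons a true) (rcons b true).
Proof.
rewrite -!cats1; split=> [ab|[ab0 ab1]].
  by split; exact: linked_cat.
by apply: (@linked_lift 1) => -[|i [|]] // _; case: i.
Qed.

Definition linked_type_system : type_system :=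
  TypeSystem linked_refl linked_sym linked_trans linked_children.

(** Conjugation by [h] preserves [H] and turns swaps of cones into swaps of their images. *)
Lemma swappable_image h a b a' b' : H h ->
  address_image h a a' -> address_image h b b' ->
  swappable a b -> swappable a' b'.
Proof.
have [HV _ Hcomp Hinv] := H_subgroup.
move=> Hh ha hb [ab abH].
have [h' [hK h'K _]] := thompsonV_bij (HV _ Hh).
split; first exact: image_incomp (can_inj hK) ha hb ab.
move=> c; rewrite -(swap_conj hK h'K (incomp_cat c c ab)
  (image_cat c ha) (image_cat c hb)).
exact: Hcomp (Hinv _ _ Hh hK h'K) (Hcomp _ _ (abH c) Hh).
Qed.

Lemma swappable_linked a b : swappable a b -> linked a b.
Proof.
move=> ab; apply: linked_deep => c; move/(swappable_cat c): ab.
move: (a ++ c) (b ++ c) => {}a {}b ab ta.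
have [N NP] := room P_branching 2 ta; exists N => d sd.
have [|u Pu ul] := NP [:: a ++ d; b ++ d] isT.
  by move=> x; rewrite !inE => /orP[] /eqP ->; rewrite size_cat sd leq_addl.
have au : swappable (a ++ d) ((a ++ u) ++ d).
  apply: same_type_swappable; last exact/same_type_cat/same_type_sym.
  by rewrite incomp_sym; apply: incomp_catl; apply: ul; rewrite !inE eqxx.
exists ((a ++ u) ++ d); split => //.
apply: swappable_trans (swappable_sym au) (swappable_cat d ab).
by apply: incomp_catl; apply: ul; rewrite !inE eqxx orbT.
Qed.

(** The middle address [e] may have no image under [h], but its deep descendants do. The images of
    the two swappable pairs are linked, and transitivity joins them. *)
Lemma linked_image h a b a' b' : H h ->
  address_image h a a' -> address_image h b b' -> linked a b -> linked a' b'.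
Proof.
have [HV _ _ _] := H_subgroup.
move=> Hh ha hb [n nP]; apply: (@linked_lift n) => c /nP[e [ae eb]].
have [N NP] := thompsonV_image (HV _ Hh).
apply: (@linked_lift N) => d sd.
have [|e' _ he] := NP (e ++ d); first by rewrite size_cat sd leq_addl.
have image x x' : address_image h x x' ->
    address_image h ((x ++ c) ++ d) ((x' ++ c) ++ d).
  by move=> hx; do 2!apply: image_cat.
apply: (@linked_trans _ e'); apply: swappable_linked.
  exact: swappable_image Hh (image _ _ ha) he (swappable_cat d ae).
exact: swappable_image Hh he (image _ _ hb) (swappable_cat d eb).
Qed.

Lemma overgroup_dichotomy : simple P -> H = stabV P \/ H = thompsonV.
Proof.
move=> sP; have [HV Hid Hcomp Hinv] := H_subgroup.
have [lP|lU] := @simple_quotient P linked_type_system sP same_type_linked.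
  left; apply/seteqP; split=> // h Hh; have Vh := HV _ Hh.
  have [h' [hK h'K _]] := thompsonV_bij Vh.
  (* The threshold is [0] because linkedness is preserved wherever [h] is defined on addresses; the
     inverse of [h] gives the converse implication. *)
  apply/stabV_P; split=> //; exists 0 => a b a' b' _ _ ha hb.
  split=> /same_type_linked ab; apply: lP; first exact: (linked_image Hh ha hb ab).
  exact: (linked_image (Hinv _ _ Hh hK h'K) (image_can hK ha) (image_can hK hb)).
right; apply/seteqP; split=> //; apply: thompsonV_generated => // a b ab.
by apply: linked_swap => //; exact: lU.
Qed.

End Overgroup.

Theorem theorem5p12 : forall P : type_system,
  simple P ->
  multinuclear P \/ atomic_branching_quasinuclear P ->
  maximal_subgroup thompsonV (stabV P).
Proof.
move=> P sP nP; have [t Pt] : exists t, self_branching P t.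
  case: nP => [|[t [Q [R [QR _ bQ]]]]]; first exact: multinuclear_self_branching.
  by exists t; exact: quasinuclear_self_branching QR bQ.
split; first exact: stabV_subgroup.
  exact: stabV_proper Pt (simple_nonuniversal sP).
by move=> H sH PH; exact: (overgroup_dichotomy Pt sH PH sP).
Qed.
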